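(* Let $s\ge0$, $T>0$, $u_0\in H^s(\mathbb S)$, and let $u=u(x,t)\in C([-T,T]:H^s(\mathbb S))$ be the corresponding solution of the periodic problem $$\partial_t u+(1-\partial_x^2)^{-1}(\partial_x u+u\,\partial_x u)=0,\qquad u(x,0)=u_0(x),\quad x\in\mathbb S.$$ If there exist $t_0\in(-T,T)$ and $a,b\in\mathbb S\cong[0,1)$ with $a<b$ such that (i) $u(x,t_0)=-1$ for a.e. $x\in(a,b)$, and (ii) $\partial_tu(b,t_0)\ge\partial_tu(a,t_0)$, then $u(x,t)=-1$ for all $(x,t)\in\mathbb S\times[-T,T]$ if $s>1/2$, and for a.e. $(x,t)\in\mathbb S\times[-T,T]$ if $s\in[0,1/2]$.
   Context: $\mathbb S=\mathbb R/\mathbb Z\cong[0,1)$, and $H^s(\mathbb S)$ is the usual $L^2$-based Sobolev space of real-valued functions. The nonlocal term is understood as $\partial_x(1-\partial_x^2)^{-1}\big(u+\tfrac{u^2}{2}\big)$, where $\partial_x(1-\partial_x^2)^{-1}h=\partial_x\mathcal G*h$ (convolution on $\mathbb S$) with $$\mathcal G(x)=\frac{\cosh(x-\lfloor x\rfloor-1/2)}{2\sinh(1/2)},\qquad \partial_x\mathcal G(x)=\frac{\sinh(x-\lfloor x\rfloor-1/2)}{2\sinh(1/2)} .$$ A solution satisfies $u(t)=u_0-\int_0^t\partial_x(1-\partial_x^2)^{-1}(u+\tfrac{u^2}{2})(t')\,dt'$. It is known (Rosier-Zhang) that for every $s\ge0$, $u_0\in H^s(\mathbb S)$ and $T>0$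 there is a unique solution $u\in C([-T,T]:H^s(\mathbb S))$. If $u\in C([-T,T]:L^2(\mathbb S))$ is a solution then $\partial_tu\in C(\mathbb S\times[-T,T])$, so (ii) is meaningful pointwise. *)

(* Defs.v *)
From HB Require Import structures.
From mathcomp Require Import all_boot all_order all_algebra.
From mathcomp Require Import all_classical all_reals all_analysis.

Set Implicit Arguments.
Unset Strict Implicit.
Unset Printing Implicit Defensive.

Import Order.TTheory GRing.Theory Num.Theory.
Import numFieldNormedType.Exports.

Local Open Scope classical_set_scope.
Local Open Scope ring_scope.

(* Functions on S = R/Z are 1-periodic functions R -> R, [0, 1[ being the
   fundamental domain for norms and integrals.  A curve with values in a
   function space on S is u : R -> R -> R, where u t is (a representative of)
   the value at time t; what is usually written u(x,t) is u t x. *)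

Section circle.
Variable R : realType.
Implicit Types (f g : R -> R) (u : R -> R -> R) (s t T x : R).

Local Notation mu := (@lebesgue_measure R).

Definition L2 f : Prop :=
  periodic f 1 /\ f \_ `[0, 1[ \in Lfun mu 2%:E.

Definition L2_norm f : \bar R :=
  'N[mu]_(2%:E) [EFin \o (f \_ `[0, 1[)%R]%E.

(* The k-th Fourier coefficient of the real function f is
   fourier_cos f k - i fourier_sin f k. *)
Definition fourier_cos f (k : int) : R :=
  \int[mu]_(x in `[0, 1[) (f x * cos (2 * pi * k%:~R * x)).
Definition fourier_sin f (k : int) : R :=
  \int[mu]_(x in `[0, 1[) (f x * sin (2 * pi * k%:~R * x)).

(* 1 + (2 pi k)^2 is the symbol of 1 - d_x^2 on R/Z, so that Hs_norm s f is the
   L^2-norm of (1 - d_x^2)^(s/2) f. *)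
Definition bessel_weight s (k : int) : R := (1 + (2 * pi * k%:~R) ^+ 2) `^ s.

Definition Hs_norm s f : \bar R :=
  ((\esum_(k in [set: int])
      (bessel_weight s k
        * (fourier_cos f k ^+ 2 + fourier_sin f k ^+ 2))%:E) `^ 2^-1)%E.

Definition Hs s f : Prop := L2 f /\ (Hs_norm s f < +oo)%E.

(* u \in C([-T, T] : H^s(S)) *)
Definition C_Hs s T u : Prop :=
  (forall t, t \in `[- T, T] -> Hs s (u t)) /\
  (forall t, t \in `[- T, T] ->
     Hs_norm s (u t' \- u t) @[t' --> within `[- T, T] (nbhs t)] --> 0%E).

(* The elements of H^s(S) are classes of a.e. equal functions.  To speak of
   u as a function of (x, t), representatives of the classes u t are chosen
   as usual: the continuous one if 1/2 < s (H^s(S) is included in C(S)), and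
   otherwise ones which make u jointly measurable, without which "for a.e.
   (x, t)" would depend on the choice of representatives. *)
Definition space_time_representative s T u : Prop :=
  (1 / 2 < s -> forall t, t \in `[- T, T] -> continuous (u t)) /\
  (s <= 1 / 2 ->
     measurable_fun (`[0 : R, 1[ `*` `[- T, T]) (fun z : R * R => u z.2 z.1)).

Definition sinh x : R := (expR x - expR (- x)) / 2.

(* d_x G, where G is the Green function of 1 - d_x^2 on S *)
Definition dG x : R :=
  sinh (x - (Num.floor x)%:~R - 1 / 2) / (2 * sinh (1 / 2)).

Definition convolution f g x : R := \int[mu]_(y in `[0, 1[) (f (x - y) * g y).

(* d_x (1 - d_x^2)^-1 (f + f^2 / 2) *)
Definition nonlocal_term f : R -> R :=
  convolution dG (fun y => f y + f y ^+ 2 / 2).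

Definition oriented_integral (h : R -> R) t : R :=
  if 0 <= t then \int[mu]_(r in `[0, t]) h r
  else - \int[mu]_(r in `[t, 0]) h r.

(* The integrand is continuous in (x, t'), so that the integral of the
   H^s-valued function of t' is computed pointwise in x. *)
Definition is_solution s T (u0 : R -> R) u : Prop :=
  C_Hs s T u /\
  forall t, t \in `[- T, T] ->
    \forall x \ae mu, x \in `[0, 1[ ->
      u t x = u0 x - oriented_integral (fun t' => nonlocal_term (u t') x) t.

(* du is the (unique) version of the time derivative of u, taken in L^2(S),
   which is continuous on S x [-T, T]; u t x itself is meaningless for a
   fixed x when s <= 1/2. *)
Definition is_time_derivative T u (du : R -> R -> R) : Prop :=
  [/\ forall t, t \in `[- T, T] -> periodic (du t) 1,
      {within [set: R] `*` `[- T, T],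
         continuous (fun z : R * R => du z.2 z.1)} &
      forall t, t \in `[- T, T] ->
        L2_norm (fun x => (u t' x - u t x) / (t' - t) - du t x)
          @[t' --> within (`[- T, T] `\ t) (nbhs t)] --> 0%E].

End circle.

(* Main.v *)
(* Put v = u + 1.  As d_x G has mean zero on the circle, the equation reads
   d_t v = - d_x G * (v^2 / 2).  At time t0 the function v vanishes on (a, b),
   and on both components of the rest of the circle y |-> d_x G (b - y) -
   d_x G (a - y) is bounded below by a positive multiple of b - a; hence
   d_t u (b) - d_t u (a) <= - c (b - a) int v^2, and (ii) forces v(t0) = 0.
   Conversely |v(t) - v(t0)| <= 1/4 | int_t0^t |v|_2^2 |, which is quadratic in v,
   so that v(t0) = 0 propagates to all times by short steps.

   For s <= 1/2 the points a and b have no meaning for u itself, so d_t u (a) and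
   d_t u (b) are approximated by difference quotients at generic points of
   (a, b) close to a and b; there the difference of the kernels keeps its lower
   bound off (a, b). *)
Require Import Defs.
From HB Require Import structures.
From mathcomp Require Import all_boot all_order all_algebra.
From mathcomp Require Import all_classical all_reals all_analysis.
From mathcomp Require Import measurable_realfun ring lra.
Import Order.TTheory GRing.Theory Num.Theory.
Import numFieldNormedType.Exports.
Local Open Scope classical_set_scope.
Local Open Scope ring_scope.

Set Implicit Arguments.
Unset Strict Implicit.
Unset Printing Implicit Defensive.

(** * Square-integrable functions on a measurable set *)

Section square_integrable.
Context d (T : measurableType d) (R : realType).
Variables (mu : {measure set T -> \bar R}) (D : set T).
Hypothesis mD : measurable D.
Implicit Types f g : T -> R.

(** A predicate relative to [D], with ordinary real values and no extension by zero. Measurability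
    of [f] is a separate clause because measurability of its square does not give it. *)
Definition square_integrable f :=
  measurable_fun D f /\ mu.-integrable D (EFin \o (fun x => f x ^+ 2)).

Lemma square_integrable_bounded f (M : R) : (mu D < +oo)%E ->
  measurable_fun D f -> (forall x, D x -> `|f x| <= M) -> square_integrable f.
Proof.
move=> muD mf fM; split=> //; apply: measurable_bounded_integrable => //.
  exact: measurable_funX.
exists (M ^+ 2); split=> [|y My x Dx]; first exact: num_real.
by rewrite /= normrX (le_trans _ (ltW My))// ler_sqr ?fM// nnegrE// (le_trans _ (fM _ Dx)).
Qed.

Lemma le_square_integrable f (h : T -> R) : measurable_fun D f ->
  mu.-integrable D (EFin \o h) -> (forall x, D x -> f x ^+ 2 <= h x) ->
  square_integrable f.
Proof.
move=> mf ih fh; split=> //; apply: le_integrable ih => //.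
  by apply/measurable_EFinP; exact: measurable_funX.
by move=> x Dx /=; rewrite lee_fin ger0_norm ?sqr_ge0// (le_trans (fh _ Dx))// ler_norm.
Qed.

Lemma square_integrableD f g :
  square_integrable f -> square_integrable g -> square_integrable (f \+ g).
Proof.
move=> [mf f2] [mg g2].
(* The majorant comes from [(f + g)^2 + (f - g)^2 = 2 f^2 + 2 g^2]. *)
apply: (@le_square_integrable _ (fun x => 2 * f x ^+ 2 + 2 * g x ^+ 2)).
- exact: measurable_funD.
- have -> : EFin \o (fun x => 2 * f x ^+ 2 + 2 * g x ^+ 2) =
    ((fun x => 2%:E * (EFin \o (fun x => f x ^+ 2)%R) x) \+
     (fun x => 2%:E * (EFin \o (fun x => g x ^+ 2)%R) x))%E by [].
  by apply: integrableD => //; apply: integrableZl.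
- by move=> x _ /=; have := sqr_ge0 (f x - g x); nra.
Qed.

Lemma square_integrableZ (k : R) f :
  square_integrable f -> square_integrable (fun x => f x * k).
Proof.
move=> [mf f2]; apply: (@le_square_integrable _ (fun x => k ^+ 2 * f x ^+ 2)).
- exact: measurable_funM.
- exact: (integrableZl mD (k ^+ 2) f2).
- by move=> x _; rewrite exprMn mulrC.
Qed.

Lemma square_integrableB f g :
  square_integrable f -> square_integrable g -> square_integrable (f \- g).
Proof.
move=> f2 /(square_integrableZ (-1)) /(square_integrableD f2).
by rewrite (_ : f \+ _ = f \- g)//; apply/funext => x /=; rewrite mulrN1.
Qed.

(* Young: [2|f||g-f| <= (g-f)^2/e + e f^2] in [g^2-f^2 = (g-f)^2 + 2f(g-f)]. *)
Lemma integral_sqrB_le f g (e : R) :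
  square_integrable f -> square_integrable g -> 0 < e ->
  \int[mu]_(x in D) `|g x ^+ 2 - f x ^+ 2| <=
  (1 + e^-1) * \int[mu]_(x in D) ((g x - f x) ^+ 2)
  + e * \int[mu]_(x in D) (f x ^+ 2).
Proof.
move=> f2 g2 e0; have [mgf gf2] := square_integrableB g2 f2.
have ifg : mu.-integrable D (EFin \o (fun x => g x ^+ 2 - f x ^+ 2)).
  exact: (integrableB mD g2.2 f2.2).
rewrite -!RintegralZl//; last exact: f2.2.
have i1 := integrableZl mD (1 + e^-1) gf2.
have i2 := integrableZl mD e f2.2.
rewrite -RintegralD//; apply: le_Rintegral => //.
- exact: (integrable_norm ifg).
- exact: (integrableD mD i1 i2).
move=> x _; set a := g x - f x; set b := f x.
have -> : g x ^+ 2 - b ^+ 2 = a ^+ 2 + 2 * (a * b) by rewrite /a /b; ring.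
have ei : e * e^-1 = 1 by rewrite mulfV// gt_eqF.
have ab : `|2 * (a * b)| <= e^-1 * a ^+ 2 + e * b ^+ 2.
  have ie0 : 0 < e^-1 by rewrite invr_gt0.
  (* The two squares bound [2 * (a * b)] from above and from below respectively. *)
  have H1 : 0 <= e^-1 * (a - e * b) ^+ 2 by rewrite mulr_ge0 ?sqr_ge0 ?ltW.
  have H2 : 0 <= e^-1 * (a + e * b) ^+ 2 by rewrite mulr_ge0 ?sqr_ge0 ?ltW.
  have E1 : e^-1 * (a - e * b) ^+ 2 = e^-1 * a ^+ 2 + e * b ^+ 2 - 2 * (a * b).
    transitivity (e^-1 * a ^+ 2 + (e * e^-1) * e * b ^+ 2 - (e * e^-1) * (2 * (a * b))).
      ring.
    by rewrite ei !mul1r.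
  have E2 : e^-1 * (a + e * b) ^+ 2 = e^-1 * a ^+ 2 + e * b ^+ 2 + 2 * (a * b).
    transitivity (e^-1 * a ^+ 2 + (e * e^-1) * e * b ^+ 2 + (e * e^-1) * (2 * (a * b))).
      ring.
    by rewrite ei !mul1r.
  rewrite ler_norml; lra.
rewrite (le_trans (ler_normD _ _))// ger0_norm ?sqr_ge0//; lra.
Qed.

End square_integrable.

(** * The [L2] norm on the circle as a real integral over [[0, 1[] *)

Section L2.
Context {R : realType}.
Notation mu := (@lebesgue_measure R).
Notation D := (`[0, 1[%classic : set R).
Implicit Types (f g : R -> R).

Lemma measurable_co01 : measurable (D : set (measurableTypeR R)). Proof. exact: measurable_itv. Qed.

Lemma lebesgue_measure_co01 : mu D = 1%E.
Proof. by rewrite lebesgue_measure_itv/= lte_fin ltr01 sube0. Qed.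

Lemma L2_norm_sqr f :
  (L2_norm f `^ 2 = \int[mu]_(x in `[0%R, 1%R[) (f x ^+ 2)%:E)%E.
Proof.
rewrite /L2_norm poweR_Lnorm// [RHS]integral_mkcond; apply: eq_integral => x _.
rewrite /= -[X in (_ `^ X)%R]/(2%:R) powR_mulrn// real_normK ?num_real// !patchE.
by case: ifPn => //; rewrite expr0n.
Qed.

Lemma L2_square_integrable f : L2 f -> square_integrable mu D f.
Proof.
move=> [_ fL]; split.
  apply/(measurable_restrictT _ measurable_co01).
  by move: fL; rewrite inE => /andP[/[!inE]].
apply/(integrable_mkcond _ measurable_co01).2.
apply: eq_integrable (Lfun2_integrable_sqr fL) => // x _.
by rewrite /= !patchE; case: ifPn => //; rewrite expr0n.
Qed.

Lemma L2_norm_le f (e : R) : 0 <= e -> square_integrable mu D f ->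
  (L2_norm f <= e%:E)%E -> \int[mu]_(x in D) (f x ^+ 2) <= e ^+ 2.
Proof.
move=> e0 [mf f2] fe; rewrite -lee_fin /Rintegral fineK; last first.
  exact: (integrable_fin_num measurable_co01 f2).
rewrite -L2_norm_sqr; apply: le_trans (_ : ((e%:E) `^ 2 <= _)%E).
  apply: gt0_ler_poweR => //; rewrite ?in_itv/= ?lee_fin ?e0 ?leey//.
  by rewrite Lnorm_ge0.
by rewrite poweR_EFin lee_fin powR_mulrn.
Qed.

End L2.

(** * The kernel [dG]: bound, monotonicity off its jump, zero mean *)

Section green_kernel.
Context {R : realType}.
Notation mu := (@lebesgue_measure R).
Notation D := (`[0, 1[%classic : set R).
Implicit Types (x y z : R).

(* [expR a - expR b = expR b * (expR (a - b) - 1) >= expR b * (a - b)] for both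
   exponentials in [sinh]. *)
Lemma sinhB_ge y x : y <= x ->
  (expR y + expR (- x)) / 2 * (x - y) <= sinh x - sinh y.
Proof.
move=> yx; have H := expR_ge1Dx (x - y).
have E1 : expR x = expR y * expR (x - y) by rewrite -expRD; congr expR; ring.
have E2 : expR (- y) = expR (- x) * expR (x - y).
  by rewrite -expRD; congr expR; ring.
have H1 : expR y * (1 + (x - y)) <= expR x by rewrite E1 ler_pM2l ?expR_gt0.
have H2 : expR (- x) * (1 + (x - y)) <= expR (- y) by rewrite E2 ler_pM2l ?expR_gt0.
rewrite /sinh; lra.
Qed.

Lemma sinhN x : sinh (- x) = - sinh x.
Proof. by rewrite /sinh opprK -mulNr opprB. Qed.

Lemma sinh_nondecreasing : {homo @sinh R : x y / x <= y}.
Proof.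
move=> y x yx; rewrite -subr_ge0 (le_trans _ (sinhB_ge yx))// mulr_ge0 ?subr_ge0//.
Qed.

Lemma sinh_half_gt0 : 0 < sinh (1 / 2 : R).
Proof.
have h : 0 <= 1 / 2 :> R by lra.
have -> : sinh (1 / 2 : R) = sinh (1 / 2) - sinh 0.
  by rewrite /sinh oppr0 subrr mul0r subr0.
by rewrite (lt_le_trans _ (sinhB_ge h))// mulr_gt0//; lra.
Qed.

Lemma continuous_sinh : continuous (@sinh R).
Proof.
move=> x; apply: cvgM; last exact: cvg_cst.
apply: cvgB; first exact: continuous_expR.
by apply: continuous_comp; [exact: opp_continuous|exact: continuous_expR].
Qed.

Lemma dG_floor (n : int) x : 0 <= x - n%:~R < 1 ->
  dG x = sinh (x - n%:~R - 1 / 2) / (2 * sinh (1 / 2)).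
Proof.
move=> /andP[x0 x1]; rewrite /dG.
by rewrite (@floor_def _ x n)// rmorphD/=; apply/andP; split; lra.
Qed.

Lemma frac_itv x : 0 <= x - (Num.floor x)%:~R < 1.
Proof.
by have /andP[] := floor_itv x; rewrite rmorphD/= => *; apply/andP; split; lra.
Qed.

(** The argument of [sinh] lies in [[-1/2, 1/2[], and [sinh] is odd and nondecreasing; the extreme
    value is [sinh (1/2) / (2 sinh (1/2))]. *)
Lemma norm_dG_le x : `|dG x| <= 1 / 2.
Proof.
have /andP[h1 h2] := frac_itv x; have s0 := sinh_half_gt0.
rewrite /dG normrM normfV (ger0_norm (_ : 0 <= 2 * sinh (1 / 2)))//; last by lra.
rewrite ler_pdivrMr; last by lra.
have -> : 1 / 2 * (2 * sinh (1 / 2)) = sinh (1 / 2 : R) by field.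
by rewrite ler_norml -sinhN !sinh_nondecreasing//; lra.
Qed.

(** Equal floors mean that no jump of [dG] separates [x] from [y], so only the growth of [sinh]
    counts. The arguments [a] and [b] of [sinh] lie in [[-1/2, 1/2[], so that [expR a] and
    [expR (- b)] are at least [1/2] by [expR z >= 1 + z]; this makes the slope of [sinh] at least
    [1/2]. *)
Lemma dGB_ge x y : x <= y -> Num.floor x = Num.floor y ->
  (4 * sinh (1 / 2))^-1 * (y - x) <= dG y - dG x.
Proof.
move=> xy fxy; have s0 := sinh_half_gt0.
have /andP[x0 x1] := frac_itv x; have /andP[y0 y1] := frac_itv y.
rewrite /dG fxy -mulrBl ler_pdivlMr; last by lra.
have -> : (4 * sinh (1 / 2))^-1 * (y - x) * (2 * sinh (1 / 2)) = (y - x) / 2.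
  by field; rewrite gt_eqF.
set a := x - _ - _; set b := y - _ - _.
have ab : a <= b by rewrite /a /b; lra.
apply: le_trans (sinhB_ge ab); have -> : b - a = y - x by rewrite /a /b; ring.
have A : 1 / 2 <= expR a.
  by apply: le_trans (expR_ge1Dx a); rewrite /a -fxy; lra.
have B : 1 / 2 <= expR (- b).
  by apply: le_trans (expR_ge1Dx (- b)); rewrite /b; lra.
by rewrite mulrC ler_wpM2r ?subr_ge0//; lra.
Qed.

Lemma dG_le x y : x \in `[0, 1[ -> y \in `[0, x] ->
  dG (x - y) = sinh (x - y - 1 / 2) / (2 * sinh (1 / 2)).
Proof.
rewrite !in_itv/= => /andP[x0 x1] /andP[y0 yx].
by rewrite (@dG_floor 0)/= ?subr0//; apply/andP; split; lra.
Qed.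

Lemma dG_gt x y : x \in `[0, 1[ -> y \in `]x, 1[ ->
  dG (x - y) = sinh (x - y + 1 / 2) / (2 * sinh (1 / 2)).
Proof.
rewrite !in_itv/= => /andP[x0 x1] /andP[xy y1].
rewrite (@dG_floor (-1))/= ?rmorphN1 ?opprK; last by apply/andP; split; lra.
by congr (sinh _ / _); lra.
Qed.

(** On [[0, 1[] the function [y |-> dG (x - y)] jumps only at [y = x], and each of its two branches
    is continuous. *)
Lemma measurable_dG x : x \in `[0, 1[ ->
  measurable_fun D (fun y => dG (x - y)).
Proof.
move=> xD.
pose g y := (if y <= x then sinh (x - y - 1 / 2) else sinh (x - y + 1 / 2))
            / (2 * sinh (1 / 2)).
have mc c : measurable_fun [set: R] (fun y => sinh (x - y + c)).
  apply: continuous_measurable_fun => y.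
  apply: (@continuous_comp _ _ _ (fun y => x - y + c) (@sinh R)); last exact: continuous_sinh.
  by apply: cvgD; [apply: cvgB; [exact: cvg_cst|exact: cvg_id]|exact: cvg_cst].
apply: (eq_measurable_fun g) => [y|].
  rewrite inE/= => yD; rewrite /g; case: ifPn => [yx|]; last rewrite -ltNge => yx.
  - rewrite dG_le//; move: yD; rewrite !in_itv/= => /andP[-> _]//.
  - rewrite dG_gt//; move: yD; rewrite !in_itv/= => /andP[_ ->]; by rewrite yx.
apply: measurable_funM => //; apply: measurable_fun_if => //.
- exact: measurable_fun_ler.
- exact: measurable_funTS.
- exact: measurable_funTS.
Qed.

(** The antiderivative is [- cosh (c - y)], written with exponentials. *)
Lemma is_derive_cosh_sub c x :
  is_derive x 1 (fun y => - (2^-1 * (expR (c - y) + expR (- (c - y)))))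
    (sinh (c - x)).
Proof.
have d0 : is_derive x 1 (fun y => c - y) (0 - 1).
  exact: (is_deriveB (is_derive_cst c x 1) (is_derive_id x 1)).
have d1 := @is_derive1_comp _ _ (fun y => c - y) _ _ _ (is_derive_expR _) d0.
have d2 := @is_derive1_comp _ _ (fun y => - (c - y)) _ _ _
  (is_derive_expR _) (is_deriveN d0).
apply: (is_derive_eq (is_deriveN (is_deriveZ 2^-1 (is_deriveD d1 d2)))).
by rewrite /sinh /GRing.scale/=; field.
Qed.

Lemma integral_sinh c a b : a <= b ->
  \int[mu]_(y in `[a, b]) sinh (c - y) =
  2^-1 * (expR (c - a) + expR (- (c - a)))
  - 2^-1 * (expR (c - b) + expR (- (c - b))).
Proof.
rewrite le_eqVlt => /predU1P[->|ab].
  by rewrite set_itv1 Rintegral_set1 subrr.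
pose F y := - (2^-1 * (expR (c - y) + expR (- (c - y)))).
have cF y : {for y, continuous F}.
  apply: differentiable_continuous; apply/derivable1_diffP.
  exact: (@ex_derive _ _ _ _ _ _ _ (is_derive_cosh_sub c y)).
rewrite /Rintegral (@continuous_FTC2 _ (fun y => sinh (c - y)) F)//=.
- by rewrite /F opprK addrC.
- apply: continuous_subspaceT => y.
  apply: (@continuous_comp _ _ _ (fun y => c - y) (@sinh R)); last exact: continuous_sinh.
  by apply: cvgB; [exact: cvg_cst|exact: cvg_id].
- split; first by move=> y _; exact: (@ex_derive _ _ _ _ _ _ _ (is_derive_cosh_sub c y)).
  + by apply: cvg_at_right_filter; exact: cF.
  + by apply: cvg_at_left_filter; exact: cF.
- move=> y _; rewrite derive1E.
  exact: (@derive_val _ _ _ _ _ _ _ (is_derive_cosh_sub c y)).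
Qed.

Lemma integrable_dGM x (h : R -> R) : x \in `[0, 1[ ->
  mu.-integrable D (EFin \o h) ->
  mu.-integrable D (EFin \o (fun y => dG (x - y) * h y)).
Proof.
move=> xD ih; apply: (integrableMr measurable_co01 (measurable_dG xD) _ ih).
exists (1 / 2); split=> [|M hM y _]; first exact: num_real.
exact: le_trans (norm_dG_le _) (ltW hM).
Qed.

Lemma integrable_cst_co01 (c : R) : mu.-integrable D (EFin \o (fun=> c)).
Proof.
apply: measurable_bounded_integrable => //.
  by rewrite [ltLHS]lebesgue_measure_co01 ltry.
exists `|c|; split=> [|M hM y _]; first exact: num_real.
exact: ltW.
Qed.

(** Splitting at the jump [y = x], the two pieces are, up to the common factor,
    [cosh (x - 1/2) - cosh (1/2)] and [cosh (1/2) - cosh (x - 1/2)]. *)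
Lemma integral_dG x : x \in `[0, 1[ ->
  \int[mu]_(y in `[0, 1[) dG (x - y) = 0.
Proof.
move=> xD; have := xD; rewrite in_itv/= => /andP[x0 x1].
have iD : mu.-integrable D (EFin \o (fun y => dG (x - y))).
  have := integrable_dGM xD (integrable_cst_co01 1).
  by apply: eq_integrable => // y _ /=; rewrite mulr1.
have is_ (a b c : R) : mu.-integrable `[a, b] (EFin \o (fun y => sinh (c - y))).
  apply: continuous_compact_integrable; first exact: segment_compact.
  apply: continuous_subspaceT => y.
  apply: (@continuous_comp _ _ _ (fun y => c - y) (@sinh R)); last exact: continuous_sinh.
  by apply: cvgB; [exact: cvg_cst|exact: cvg_id].
have -> : \int[mu]_(y in `[0, 1[) dG (x - y) =
   \int[mu]_(y in `[0, x]) dG (x - y) + \int[mu]_(y in `]x, 1[) dG (x - y).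
  by rewrite -(Rintegral_itvB (x := x) iD) ?bnd_simp// addrC subrK.
have -> : \int[mu]_(y in `[0, x]) dG (x - y) =
    \int[mu]_(y in `[0, x]) (sinh (x - 1 / 2 - y) * (2 * sinh (1 / 2))^-1).
  apply: eq_Rintegral => y; rewrite inE/= => yx.
  by rewrite dG_le// addrAC.
have -> : \int[mu]_(y in `]x, 1[) dG (x - y) =
    \int[mu]_(y in `]x, 1[) (sinh (x + 1 / 2 - y) * (2 * sinh (1 / 2))^-1).
  apply: eq_Rintegral => y; rewrite inE/= => yx.
  by rewrite dG_gt// addrAC.
have i1 : mu.-integrable `]x, 1] (EFin \o (fun y => sinh (x + 1 / 2 - y))).
  apply: integrableS (is_ x 1 (x + 1 / 2)) => //.
  by apply: subset_itvr; rewrite bnd_simp.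
have i2 : mu.-integrable `]x, 1[ (EFin \o (fun y => sinh (x + 1 / 2 - y))).
  apply: integrableS i1 => //.
  by apply: subset_itvl; rewrite bnd_simp.
rewrite RintegralZr// RintegralZr// Rintegral_itv_bndo_bndc//.
rewrite Rintegral_itv_obnd_cbnd// !integral_sinh ?(ltW x1)//.
have -> : x - 1 / 2 - 0 = x - 1 / 2 by ring.
have -> : x - 1 / 2 - x = - (1 / 2) by ring.
have -> : x + 1 / 2 - x = 1 / 2 by ring.
have -> : x + 1 / 2 - 1 = x - 1 / 2 by field.
by rewrite opprK; ring.
Qed.

End green_kernel.

(** * Almost everywhere statements and integrals *)

Section ae_integral.
Context d (T : measurableType d) (R : realType).
Variables (mu : {measure set T -> \bar R}) (D : set T).
Hypothesis mD : measurable D.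

Lemma aeS (P Q : T -> Prop) : (forall x, P x -> Q x) ->
  {ae mu, forall x, P x} -> {ae mu, forall x, Q x}.
Proof. by move=> PQ; exact: filterS. Qed.

Lemma aeI (P Q : T -> Prop) : {ae mu, forall x, P x} -> {ae mu, forall x, Q x} ->
  {ae mu, forall x, P x /\ Q x}.
Proof. exact: filterI. Qed.

(** Replacing [h] by its absolute value changes the integral on a null set only. Applied to a
    difference, this compares integrals whose integrands are ordered merely a.e. *)
Lemma ae_Rintegral_ge0 (h : T -> R) : measurable_fun D h ->
  {ae mu, forall x, D x -> 0 <= h x} -> 0 <= \int[mu]_(x in D) h x.
Proof.
move=> mh h0; rewrite /Rintegral (@ae_eq_integral _ _ _ _ _ (fun x => `|h x|%:E))//.
- exact: Rintegral_ge0.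
- exact/measurable_EFinP.
- by apply/measurable_EFinP; exact: measurableT_comp.
- by apply: filterS h0 => x h0 Dx; rewrite ger0_norm// h0.
Qed.

End ae_integral.

(** * The nonlocal term as a quadratic expression in [f + 1] *)

Section nonlocal.
Context {R : realType}.
Notation mu := (@lebesgue_measure R).
Notation D := (`[0, 1[%classic : set R).
Implicit Types (f g : R -> R) (x : R).

Lemma square_integrable_cst1 : square_integrable mu D (cst 1).
Proof.
apply: (@square_integrable_bounded _ _ _ _ _ measurable_co01 _ 1) => //.
  by rewrite [ltLHS]lebesgue_measure_co01 ltry.
by move=> x _; rewrite normr1.
Qed.

Lemma square_integrableD1 f : square_integrable mu D f ->
  square_integrable mu D (fun x => f x + 1).
Proof.
by move=> f2; apply: (square_integrableD measurable_co01 f2 square_integrable_cst1).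
Qed.

(* [f + f^2/2 = (f + 1)^2/2 - 1/2] and [dG] has mean zero. *)
Lemma nonlocal_termE f x : square_integrable mu D f -> x \in `[0, 1[ ->
  nonlocal_term f x = 1 / 2 * \int[mu]_(y in `[0, 1[) (dG (x - y) * (f y + 1) ^+ 2).
Proof.
move=> f2 xD; have [_ i2] := square_integrableD1 f2.
have i1 := integrable_dGM xD i2.
have i0 := integrable_dGM xD (integrable_cst_co01 1).
rewrite -[RHS]subr0 -[X in _ - X](mulr0 (1 / 2)) -[X in _ - _ * X](integral_dG xD).
have -> : \int[mu]_(y in `[0, 1[) dG (x - y) = \int[mu]_(y in `[0, 1[) (dG (x - y) * 1).
  by apply: eq_Rintegral => y _; rewrite mulr1.
rewrite -mulrBr -RintegralB// -RintegralZl//; last first.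
  exact: (integrableB measurable_co01 i1 i0).
by apply: eq_Rintegral => y _; field.
Qed.

(** One factor [1/2] of the constant comes from [v^2 / 2] with [v = f + 1], the other from the bound
    on [dG]. *)
Lemma nonlocal_termB_le f g x : square_integrable mu D f ->
  square_integrable mu D g -> x \in `[0, 1[ ->
  `|nonlocal_term g x - nonlocal_term f x| <=
  1 / 4 * \int[mu]_(y in `[0, 1[) `|(g y + 1) ^+ 2 - (f y + 1) ^+ 2|.
Proof.
move=> f2 g2 xD.
have [_ if2] := square_integrableD1 f2; have [_ ig2] := square_integrableD1 g2.
have iB := integrableB measurable_co01 ig2 if2.
rewrite !nonlocal_termE// -mulrBr -RintegralB//; last 2 first.
- exact: (integrable_dGM xD ig2).
- exact: (integrable_dGM xD if2).
have i := integrableB measurable_co01 (integrable_dGM xD ig2) (integrable_dGM xD if2).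
rewrite normrM ger0_norm; last lra.
rewrite (_ : 1 / 4 * _ = 1 / 2 * (1 / 2 *
  \int[mu]_(y in `[0, 1[) `|(g y + 1) ^+ 2 - (f y + 1) ^+ 2|)); last by field.
rewrite ler_pM2l; last lra.
rewrite (le_trans (le_normr_Rintegral measurable_co01 i))//.
rewrite -RintegralZl//; last exact: (integrable_norm iB).
apply: le_Rintegral => //.
- exact: (integrable_norm i).
- exact: (integrableZl measurable_co01 (1 / 2) (integrable_norm iB)).
- by move=> y _; rewrite -mulrBr normrM ler_wpM2r// norm_dG_le.
Qed.

(** This is the previous estimate against the constant [-1], whose nonlocal term vanishes. *)
Lemma norm_nonlocal_term_le f x : square_integrable mu D f -> x \in `[0, 1[ ->
  `|nonlocal_term f x| <= 1 / 4 * \int[mu]_(y in `[0, 1[) ((f y + 1) ^+ 2).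
Proof.
move=> f2 xD.
have m1 : square_integrable mu D (cst (-1)).
  apply: (@square_integrable_bounded _ _ _ _ _ measurable_co01 _ 1) => //.
    by rewrite [ltLHS]lebesgue_measure_co01 ltry.
  by move=> y _; rewrite normrN1.
have := nonlocal_termB_le m1 f2 xD.
rewrite (_ : nonlocal_term (cst (-1)) x = 0) ?subr0.
  under eq_Rintegral do rewrite addNr expr0n subr0 ger0_norm ?sqr_ge0//.
  by [].
rewrite nonlocal_termE//.
under eq_Rintegral do rewrite addNr expr0n mulr0.
by rewrite Rintegral_cst ?mul0r ?mulr0//; exact: measurable_co01.
Qed.

(** The quantitative core of the rigidity. The integrand vanishes for a.e. [y] in [(a, b)]; for the
    other [y] the kernel increases by at least a multiple of [x2 - x1]. Staying strictly inside
    [(a, b)] keeps [x1] and [x2] on the same side of the jump at [y]. *)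
Lemma nonlocal_term_increment f (a b x1 x2 : R) : square_integrable mu D f ->
  0 <= a -> b < 1 -> a < x1 -> x1 <= x2 -> x2 < b ->
  {ae mu, forall y, y \in `]a, b[ -> f y = -1} ->
  (8 * sinh (1 / 2))^-1 * (x2 - x1) * \int[mu]_(y in `[0, 1[) ((f y + 1) ^+ 2) <=
  nonlocal_term f x2 - nonlocal_term f x1.
Proof.
move=> f2 a0 b1 ax1 x12 x2b fab.
have x1D : x1 \in `[0, 1[ by rewrite in_itv/=; apply/andP; split; lra.
have x2D : x2 \in `[0, 1[ by rewrite in_itv/=; apply/andP; split; lra.
have [_ i2] := square_integrableD1 f2.
have i12 := integrableB measurable_co01 (integrable_dGM x2D i2) (integrable_dGM x1D i2).
rewrite !nonlocal_termE// -mulrBr -RintegralB//; last 2 first.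
- exact: (integrable_dGM x2D i2).
- exact: (integrable_dGM x1D i2).
pose k := (4 * sinh (1 / 2 : R))^-1 * (x2 - x1).
have -> : (8 * sinh (1 / 2))^-1 * (x2 - x1) = 1 / 2 * k.
  by rewrite /k; field; rewrite gt_eqF// sinh_half_gt0.
rewrite -mulrA ler_pM2l; last lra.
rewrite -RintegralZl//.
have ik := integrableZl measurable_co01 k i2.
rewrite -subr_ge0 -RintegralB//.
have iB := integrableB measurable_co01 i12 ik.
apply: ae_Rintegral_ge0 => //.
  by apply/measurable_EFinP; exact: (measurable_int mu iB).
apply: aeS fab => y fab; rewrite /= in_itv/= => /andP[y0 y1].
rewrite -mulrBl -mulrBl.
have [yab|yab] := boolP (y \in `]a, b[).
  by rewrite fab// addNr expr0n mulr0.
rewrite mulr_ge0 ?sqr_ge0// subr_ge0.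
have -> : k = (4 * sinh (1 / 2))^-1 * ((x2 - y) - (x1 - y)) by rewrite /k; ring.
apply: dGB_ge; first lra.
(* Left of the interval both [x1 - y] and [x2 - y] lie in [[0, 1[], right of it both lie in [[-1,
   0[]. *)
move: yab; rewrite in_itv/= negb_and -!leNgt => /orP[ya|yb].
- by rewrite !(@floor_def _ _ 0)//=; apply/andP; split; lra.
- by rewrite !(@floor_def _ _ (-1))//= rmorphN1; apply/andP; split; lra.
Qed.

End nonlocal.

(** * Increments of the oriented time integral *)

Section oriented_integral.
Context {R : realType}.
Notation mu := (@lebesgue_measure R).
Variables (T : R) (h : R -> R).
Hypothesis ih : mu.-integrable `[- T, T] (EFin \o h).

Let ihab (a b : itv_bound R) : (BLeft (- T) <= a)%O -> (b <= BRight T)%O ->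
  mu.-integrable [set` Interval a b] (EFin \o h).
Proof. by move=> aT bT; apply: integrableS ih => //; exact: subset_itv. Qed.

Lemma oriented_integralB (t t' : R) : - T <= t -> t <= t' -> t' <= T ->
  oriented_integral h t' - oriented_integral h t = \int[mu]_(r in `[t, t']) h r.
Proof.
move=> Tt tt' t'T.
have split_ (a b c : R) : - T <= a -> a <= b -> b <= c -> c <= T ->
    \int[mu]_(r in `[a, c]) h r =
    \int[mu]_(r in `[a, b]) h r + \int[mu]_(r in `[b, c]) h r.
  move=> Ta ab bc cT.
  rewrite -[X in _ = _ + X]Rintegral_itv_obnd_cbnd; last first.
    by apply: ihab; rewrite bnd_simp// (le_trans Ta).
  rewrite -(@Rintegral_itvB _ h (BLeft a) (BRight c) b) ?bnd_simp//; last first.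
    by apply: ihab; rewrite bnd_simp.
  by rewrite addrC subrK.
have T0 : - T <= 0 /\ 0 <= T by split; lra.
rewrite /oriented_integral; case: (leP 0 t) => t0.
  by rewrite (le_trans t0 tt') (split_ 0 t t') ?T0.1// addrAC subrr add0r.
case: (leP 0 t') => t'0.
  by rewrite opprK (split_ t 0 t') ?(ltW t0)// addrC.
by rewrite opprK (split_ t t' 0) ?(ltW t'0) ?T0.2// addrC addrK.
Qed.

(** It serves twice: [c = 0] bounds increments of the solution, and [c] equal to the integrand at
    [t] shows that difference quotients approach that integrand. *)
Lemma oriented_integralB_le (c e t t' : R) : t \in `[- T, T] -> t' \in `[- T, T] ->
  (forall r : R, Num.min t t' <= r <= Num.max t t' -> `|h r - c| <= e) ->
  `|oriented_integral h t' - oriented_integral h t - c * (t' - t)| <= e * `|t' - t|.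
Proof.
wlog tt' : t t' / t <= t' => [wl|].
  case/orP: (le_total t t') => [tt'|t't]; first exact: (wl t t').
  move=> tT t'T; rewrite minC maxC => he.
  rewrite distrC (distrC t'); apply: le_trans (wl _ _ t't t'T tT he).
  by rewrite le_eqVlt; apply/orP; left; apply/eqP; congr (Num.norm _); ring.
rewrite !in_itv/= min_l// max_r// => /andP[Tt _] /andP[_ t'T] he.
rewrite oriented_integralB//.
have iht : mu.-integrable `[t, t'] (EFin \o h) by apply: ihab; rewrite bnd_simp.
have ic k : mu.-integrable `[t, t'] (EFin \o (fun=> k : R)).
  apply: continuous_compact_integrable; first exact: segment_compact.
  by apply: continuous_subspaceT => y; exact: cvg_cst.
have mtt' : fine (mu `[t, t']) = t' - t.
  rewrite lebesgue_measure_itv/= lte_fin; case: ltP => //= t't.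
  by apply/eqP; rewrite eq_sym subr_eq0 eq_le t't tt'.
have -> : c * (t' - t) = \int[mu]_(r in `[t, t']) c.
  by rewrite Rintegral_cst// mtt'.
have -> : e * `|t' - t| = \int[mu]_(r in `[t, t']) e.
  by rewrite Rintegral_cst// mtt' ger0_norm// subr_ge0.
rewrite -RintegralB//.
have iB := @integrableB _ _ _ mu _ (measurable_itv _) _ _ iht (ic c).
apply: (le_trans (@le_normr_Rintegral _ _ _ mu _ (fun r => h r - c) (measurable_itv _) iB)).
by apply: le_Rintegral => //; exact: (integrable_norm iB).
Qed.

End oriented_integral.

(** * Generic points, null integrals and continuity in epsilon-delta form *)

Section ae_lebesgue.
Context {R : realType}.
Notation mu := (@lebesgue_measure R).
Notation D := (`[0, 1[%classic : set R).
Implicit Types (f g : R -> R).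

Lemma continuous_square_integrable f : continuous f -> square_integrable mu D f.
Proof.
move=> cf; have mf : measurable_fun D f.
  by apply: measurable_funTS; exact: continuous_measurable_fun.
split=> //.
have : mu.-integrable `[0, 1] (EFin \o (fun x => f x ^+ 2)).
  apply: continuous_compact_integrable; first exact: segment_compact.
  apply: continuous_subspaceT => x; apply: cvgM; exact: cf.
apply: integrableS => //.
by apply: subset_itvl; rewrite bnd_simp.
Qed.

(** Chebyshev's argument: without such a point, [g ^+ 2] would be at least [e ^+ 2] a.e. on
    [(c, d)], and its integral would be too large. *)
Lemma ae_pick_small g (P : R -> Prop) (e c d : R) : square_integrable mu D g ->
  {ae mu, forall x, P x} -> 0 <= c -> c < d -> d <= 1 -> 0 <= e ->
  \int[mu]_(x in `[0, 1[) (g x ^+ 2) < e ^+ 2 * (d - c) ->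
  exists x, [/\ c < x, x < d, P x & `|g x| <= e].
Proof.
move=> [mg g2] aeP c0 cd d1 e0; rewrite ltNge => /negP gsmall; apply: contrapT => noex.
apply: gsmall.
have cdD : `]c, d[ `<=` D by apply: subset_itv; rewrite bnd_simp.
have ig : mu.-integrable `]c, d[ (EFin \o (fun x => g x ^+ 2)).
  by apply: integrableS g2 => //; exact: measurable_itv.
have ie : mu.-integrable `]c, d[ (EFin \o (fun=> e ^+ 2)).
  by apply: integrableS (integrable_cst_co01 (e ^+ 2)) => //; exact: measurable_itv.
apply: (@le_trans _ _ (\int[mu]_(x in `]c, d[) (g x ^+ 2))); last first.
  rewrite /Rintegral fine_le//.
  - exact: (@integrable_fin_num _ _ _ mu _ (measurable_itv _) _ ig).
  - exact: (@integrable_fin_num _ _ _ mu _ (measurable_itv _) _ g2).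
  - apply: ge0_subset_integral => //.
    + exact: (measurable_int mu g2).
    + by move=> x _; rewrite lee_fin sqr_ge0.
have -> : e ^+ 2 * (d - c) = \int[mu]_(x in `]c, d[) (e ^+ 2).
  rewrite Rintegral_cst//; congr (_ * _).
  by rewrite [X in fine X]lebesgue_measure_itv/= lte_fin cd.
have iB := @integrableB _ _ _ mu _ (measurable_itv _) _ _ ig ie.
rewrite -subr_ge0 -RintegralB//.
apply: ae_Rintegral_ge0 => //.
  by apply/measurable_EFinP; exact: (measurable_int mu iB).
apply: aeS aeP => x Px; rewrite /= in_itv/= => /andP[cx xd].
rewrite subr_ge0 -[leRHS]real_normK ?num_real// ler_sqr ?nnegrE//.
by rewrite leNgt; apply/negP => /ltW gxe; apply: noex; exists x.
Qed.

Lemma integral_sqrD1_eq0 f : square_integrable mu D f ->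
  \int[mu]_(x in `[0, 1[) ((f x + 1) ^+ 2) = 0 ->
  {ae mu, forall x, x \in `[0, 1[ -> f x = -1}.
Proof.
move=> f2 If; have [mf if2] := square_integrableD1 f2.
have /(ae_eq_integral_abs mu measurable_co01 (measurable_int mu if2)) [N [mN N0 sN]] :
    (\int[mu]_(x in `[0%R, 1%R[) `|((f x + 1) ^+ 2)%:E| = 0)%E.
  under eq_integral do rewrite gee0_abs ?lee_fin ?sqr_ge0//.
  rewrite -[LHS]fineK; last exact: (@integrable_fin_num _ _ _ mu _ measurable_co01 _ if2).
  by congr EFin.
exists N; split=> // x /= nx; apply: sN => /= H; apply: nx => xD.
have /eqP := H xD; rewrite eqe sqrf_eq0 addr_eq0 => /eqP -> //.
Qed.

Lemma near_within_delta (A : set R) (t : R) (P : R -> Prop) :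
  (\forall t' \near within A (nbhs t), P t') ->
  exists2 d, 0 < d & forall t', `|t - t'| < d -> A t' -> P t'.
Proof.
by move=> /nbhs_ballP[d /= d0 dP]; exists d => // t' tt' At'; apply: dP.
Qed.

Lemma delta_near_within (A : set R) (t d : R) (P : R -> Prop) : 0 < d ->
  (forall t', `|t - t'| < d -> A t' -> P t') ->
  \forall t' \near within A (nbhs t), P t'.
Proof. by move=> d0 dP; apply/nbhs_ballP; exists d. Qed.

Lemma continuous_delta f (x e : R) : continuous f -> 0 < e ->
  exists2 d, 0 < d & forall y, `|x - y| < d -> `|f x - f y| <= e.
Proof.
move=> cf e0; have /cvgrPdist_le/(_ _ e0)/nbhs_ballP[d /= d0 dP] := cf x.
by exists d => // y xy; apply: dP.
Qed.

Lemma continuous_ae_eq_cst f (c : R) : continuous f ->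
  {ae mu, forall x, x \in `[0, 1[ -> f x = c} ->
  forall x, x \in `[0, 1[ -> f x = c.
Proof.
move=> cf fc x; rewrite in_itv/= => /andP[x0 x1].
apply/eqP; rewrite -subr_eq0 -normr_le0 leNgt; apply/negP => fxc.
have e0 : 0 < `|f x - c| / 2 by rewrite divr_gt0.
have [d d0 dP] := continuous_delta x cf e0.
have s0 : square_integrable mu D (cst 0).
  by apply: continuous_square_integrable => y; exact: cvg_cst.
(* Taking [g = 0] merely produces a point of the full-measure set close to [x]; it is sought on the
   right, since [x] may be [0]. *)
have [||||//|y [xy yd fy _]] := @ae_pick_small _ _ 1 x (Num.min (x + d) 1) s0 fc.
- exact: x0.
- by rewrite lt_min x1 andbT ltrDl.
- by rewrite ge_min lexx orbT.
- by [].
- under eq_Rintegral do rewrite expr0n.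
  rewrite Rintegral_cst// mul0r expr1n mul1r subr_gt0.
  by rewrite lt_min x1 andbT ltrDl.
move: yd; rewrite lt_min => /andP[yd y1].
have := dP y; rewrite fy; last by rewrite in_itv/=; apply/andP; split; lra.
rewrite ltr0_norm ?subr_lt0// => H.
have : `|f x - c| <= `|f x - c| / 2 by apply: H; lra.
by lra.
Qed.

End ae_lebesgue.

(** * Continuity in time of the solution, of its energy and of the nonlocal term *)

Section time_regularity.
Context {R : realType}.
Notation mu := (@lebesgue_measure R).
Notation D := (`[0, 1[%classic : set R).
Variables (T : R) (u du : R -> R -> R).
Hypothesis u2 : forall t, t \in `[- T, T] -> square_integrable mu D (u t).
Hypothesis udu : is_time_derivative T u du.
Implicit Types (t x e : R).

Lemma continuous_time_derivative t : t \in `[- T, T] -> continuous (du t).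
Proof.
move=> tT x; have [_ /subspace_continuousP cdu _] := udu.
apply/cvgrPdist_le => e e0.
have /cvgrPdist_le/(_ e e0)[[B C] /= [xB tC] BC] := cdu (x, t) (conj I tT).
apply: filterS xB => y By; apply: (BC (y, t)); last by split.
by split=> //=; exact: nbhs_singleton.
Qed.

(** The limit of extended-real norms in [is_time_derivative], turned into a bound on an ordinary
    integral. *)
Lemma time_quotient t e : t \in `[- T, T] -> 0 < e ->
  exists2 d, 0 < d & forall t', `|t - t'| < d -> t' \in `[- T, T] -> t' != t ->
    \int[mu]_(x in `[0, 1[) (((u t' x - u t x) / (t' - t) - du t x) ^+ 2) <= e ^+ 2.
Proof.
move=> tT e0; have [_ _ /(_ t tT)/fine_cvgP[ffin /cvgr0Pnorm_le/(_ e e0) f0]] := udu.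
have [d1 d10 ffin1] := near_within_delta ffin.
have [d2 d20 f02] := near_within_delta f0.
exists (Num.min d1 d2); first by rewrite lt_min d10.
move=> t'; rewrite lt_min => /andP[tt'1 tt'2] t'T t't.
have At' : (`[- T, T]%classic `\ t) t' by split => //=; exact/eqP.
apply: L2_norm_le; first exact: ltW.
- apply: (square_integrableB measurable_co01); last first.
    by apply: continuous_square_integrable; exact: continuous_time_derivative.
  exact: (square_integrableZ measurable_co01 (t' - t)^-1
    (square_integrableB measurable_co01 (u2 t'T) (u2 tT))).
- rewrite -(fineK (ffin1 _ tt'1 At')) lee_fin.
  exact: le_trans (ler_norm _) (f02 _ tt'2 At').
Qed.

(* Read off from the time derivative rather than from [C_Hs]: the latter would
   require the completeness of the Fourier basis. *)
Lemma L2_time_continuous t e : t \in `[- T, T] -> 0 < e ->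
  exists2 d, 0 < d & forall t', `|t - t'| < d -> t' \in `[- T, T] ->
    \int[mu]_(x in `[0, 1[) ((u t' x - u t x) ^+ 2) <= e.
Proof.
move=> tT e0; have [d d0 dP] := time_quotient tT ltr01.
have [_ idu] := continuous_square_integrable (continuous_time_derivative tT).
set K := \int[mu]_(x in `[0, 1[) (du t x ^+ 2).
have K0 : 0 <= K by apply: Rintegral_ge0 => x _; exact: sqr_ge0.
(* From [u t' - u t = (t' - t) (q + du t)], with the integral of [q ^+ 2] at most [1], the bound is
   [(t' - t)^2 (2 + 2 K)]; the minimum with [1] lets [(t' - t)^2] be replaced by [|t' - t|]. *)
pose r := Num.min 1 (e / (2 + 2 * K)).
have r0 : 0 < r by rewrite lt_min ltr01 divr_gt0//; lra.
exists (Num.min d r); first by rewrite lt_min d0.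
move=> t'; rewrite lt_min => /andP[tt'd tt'r] t'T.
have [->|t't] := eqVneq t' t.
  under eq_Rintegral do rewrite subrr expr0n.
  by rewrite Rintegral_cst// mul0r ltW.
set q := fun x => (u t' x - u t x) / (t' - t) - du t x.
have q2 : square_integrable mu D q.
  apply: (square_integrableB measurable_co01); last first.
    by apply: continuous_square_integrable; exact: continuous_time_derivative.
  exact: (square_integrableZ measurable_co01 (t' - t)^-1
    (square_integrableB measurable_co01 (u2 t'T) (u2 tT))).
have [_ iB] := square_integrableB measurable_co01 (u2 t'T) (u2 tT).
have i1 := integrableZl measurable_co01 ((t' - t) ^+ 2 * 2) q2.2.
have i2 := integrableZl measurable_co01 ((t' - t) ^+ 2 * 2) idu.
have i12 := integrableD measurable_co01 i1 i2.
apply: (@le_trans _ _ ((t' - t) ^+ 2 * 2 * \int[mu]_(x in `[0, 1[) (q x ^+ 2)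
                       + (t' - t) ^+ 2 * 2 * K)).
  rewrite -!RintegralZl//; last exact: q2.2.
  rewrite -RintegralD//; apply: le_Rintegral => // x _.
  have -> : u t' x - u t x = (t' - t) * (q x + du t x).
    by rewrite /q; field; rewrite subr_eq0.
  rewrite exprMn; move: (sqr_ge0 (t' - t)); move: ((t' - t) ^+ 2) => S S0.
  by have := mulr_ge0 S0 (sqr_ge0 (q x - du t x)); nra.
have := dP t' tt'd t'T t't; rewrite expr1n -/q; set Q := Rintegral _ _ _ => Q1.
have Q0 : 0 <= Q by apply: Rintegral_ge0 => x _; exact: sqr_ge0.
move: tt'r; rewrite distrC lt_min => /andP[t1 te].
have te2 : (t' - t) ^+ 2 <= e / (2 + 2 * K).
  rewrite -real_normK ?num_real// expr2.
  have := normr_ge0 (t' - t); nra.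
move: te2; rewrite ler_pdivlMr; last lra.
have := sqr_ge0 (t' - t); nra.
Qed.

Lemma energy_time_continuous t e : t \in `[- T, T] -> 0 < e ->
  exists2 d, 0 < d & forall t', `|t - t'| < d -> t' \in `[- T, T] ->
    \int[mu]_(x in `[0, 1[) `|(u t' x + 1) ^+ 2 - (u t x + 1) ^+ 2| <= e.
Proof.
move=> tT e0; set K := \int[mu]_(x in `[0, 1[) ((u t x + 1) ^+ 2).
have K0 : 0 <= K by apply: Rintegral_ge0 => x _; exact: sqr_ge0.
(* The weight [r] in Young's inequality makes the term in [K] at most [e / 2], and [e'] does so for
   the other term; [K + 1] avoids a zero denominator. *)
pose r := e / (2 * (K + 1)).
have r0 : 0 < r by rewrite divr_gt0//; lra.
pose e' := e / 2 / (1 + r^-1).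
have rV0 : 0 < r^-1 by rewrite invr_gt0.
have e'0 : 0 < e' by rewrite divr_gt0 ?divr_gt0//; lra.
have [d d0 dP] := L2_time_continuous tT e'0.
exists d => // t' tt' t'T; have := dP _ tt' t'T.
have := integral_sqrB_le measurable_co01 (square_integrableD1 (u2 tT))
  (square_integrableD1 (u2 t'T)) r0.
rewrite (_ : Rintegral mu D (fun x => (u t' x + 1 - (u t x + 1)) ^+ 2) =
  \int[mu]_(x in `[0, 1[) ((u t' x - u t x) ^+ 2)); last first.
  by apply: eq_Rintegral => x _; congr (_ ^+ 2); ring.
move=> H1 H2; apply: le_trans H1 _; rewrite -/K.
have H3 : r * K <= e / 2.
  rewrite /r -mulrA ler_pM2l// mulrC ler_pdivrMr; lra.
have H4 : (1 + r^-1) * \int[mu]_(x in `[0, 1[) ((u t' x - u t x) ^+ 2) <= e / 2.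
  by rewrite mulrC -ler_pdivlMr//; lra.
lra.
Qed.

Lemma delta_within_continuous (h : R -> R) :
  (forall t e, t \in `[- T, T] -> 0 < e -> exists2 d, 0 < d &
    forall t', `|t - t'| < d -> t' \in `[- T, T] -> `|h t' - h t| <= e) ->
  {within `[- T, T], continuous h}.
Proof.
move=> hd; apply/subspace_continuousP => t /= tT; apply/cvgrPdist_le => e e0.
have [d d0 dP] := hd t e tT e0; apply: (delta_near_within d0) => t' tt' t'T.
by rewrite distrC dP.
Qed.

(** The radius [d] does not depend on [x], because the bound on the kernel is uniform. *)
Lemma nonlocal_term_time_delta t e : t \in `[- T, T] -> 0 < e ->
  exists2 d, 0 < d & forall t', `|t - t'| < d -> t' \in `[- T, T] ->
    forall x, x \in `[0, 1[ -> `|nonlocal_term (u t') x - nonlocal_term (u t) x| <= e.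
Proof.
move=> tT e0; have [d d0 dP] := energy_time_continuous tT e0.
exists d => // t' tt' t'T x xD.
apply: le_trans (nonlocal_termB_le (u2 tT) (u2 t'T) xD) _.
have := dP t' tt' t'T; set I := Rintegral _ _ _.
have : 0 <= I by apply: Rintegral_ge0 => y _; exact: normr_ge0.
lra.
Qed.

Lemma nonlocal_term_time_integrable x : x \in `[0, 1[ ->
  mu.-integrable `[- T, T] (EFin \o (fun t => nonlocal_term (u t) x)).
Proof.
move=> xD; apply: continuous_compact_integrable; first exact: segment_compact.
apply: delta_within_continuous => t e tT e0.
have [d d0 dP] := nonlocal_term_time_delta tT e0.
by exists d => // t' tt' t'T; exact: dP.
Qed.

Lemma energy_bounded : 0 < T -> exists M, forall t, t \in `[- T, T] ->
  \int[mu]_(x in `[0, 1[) ((u t x + 1) ^+ 2) <= M.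
Proof.
move=> T0.
have [|t|c cT cmax] := @EVT_max _ (fun t => \int[mu]_(x in `[0, 1[) ((u t x + 1) ^+ 2)) (- T) T.
- by lra.
- apply: delta_within_continuous => {}t e tT e0.
  have [d d0 dP] := energy_time_continuous tT e0.
  exists d => // t' tt' t'T; apply: le_trans (dP _ tt' t'T).
  have [_ i1] := square_integrableD1 (u2 t'T).
  have [_ i2] := square_integrableD1 (u2 tT).
  rewrite -RintegralB//.
  have iB := integrableB measurable_co01 i1 i2.
  exact: (le_normr_Rintegral measurable_co01 iB).
- by eexists; exact: cmax.
Qed.

End time_regularity.

Lemma exists_pos_lt (R : realFieldType) (x y z : R) : 0 < x -> 0 < y -> 0 < z ->
  exists n, [/\ 0 < n, n <= x, n < y & n < z].
Proof.
move=> x0 y0 z0; exists (Num.min x (Num.min (y / 2) (z / 2))).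
have /and3P[h1 h2 h3] : [&& Num.min x (Num.min (y / 2) (z / 2)) <= x,
    Num.min x (Num.min (y / 2) (z / 2)) <= y / 2 &
    Num.min x (Num.min (y / 2) (z / 2)) <= z / 2] by rewrite -!le_min.
split=> //; [|lra|lra].
by rewrite !lt_min x0 !divr_gt0.
Qed.

(** * Zero energy: propagation in time, and derivation from the sign condition *)

Section rigidity.
Context {R : realType}.
Notation mu := (@lebesgue_measure R).
Notation D := (`[0, 1[%classic : set R).
Variables (T : R) (u0 : R -> R) (u du : R -> R -> R).
Hypothesis u2 : forall t, t \in `[- T, T] -> square_integrable mu D (u t).
Hypothesis udu : is_time_derivative T u du.
Hypothesis usol : forall t, t \in `[- T, T] -> \forall x \ae mu, x \in `[0, 1[ ->
  u t x = u0 x - oriented_integral (fun t' => nonlocal_term (u t') x) t.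
Implicit Types (t x e : R).

Local Notation energy t := (\int[mu]_(x in `[0, 1[) ((u t x + 1) ^+ 2)).

Let energy_ge0 t : 0 <= energy t.
Proof. by apply: Rintegral_ge0 => x _; exact: sqr_ge0. Qed.

Lemma solutionB t t' : t \in `[- T, T] -> t' \in `[- T, T] ->
  {ae mu, forall x, x \in `[0, 1[ -> u t' x - u t x =
    - (oriented_integral (fun r => nonlocal_term (u r) x) t'
       - oriented_integral (fun r => nonlocal_term (u r) x) t)}.
Proof.
move=> tT t'T; apply: aeS (aeI (usol tT) (usol t'T)) => x [ux u'x] xD.
by rewrite ux// u'x//; ring.
Qed.

Lemma itv_between t t' r : t \in `[- T, T] -> t' \in `[- T, T] ->
  Num.min t t' <= r <= Num.max t t' -> r \in `[- T, T] /\ `|t - r| <= `|t - t'|.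
Proof.
rewrite !in_itv/= => /andP[a1 a2] /andP[b1 b2].
case/orP: (le_total t t') => tt'.
  rewrite min_l// max_r// => /andP[c1 c2]; split; first by apply/andP; split; lra.
  by rewrite distrC (distrC t) !ger0_norm ?subr_ge0//; lra.
rewrite min_r// max_l// => /andP[c1 c2]; split; first by apply/andP; split; lra.
by rewrite !ger0_norm ?subr_ge0//; lra.
Qed.

(** Since [u t = -1] a.e., [u t' + 1] is the increment of [u], at most [B / 4 * |t' - t|] in
    absolute value for a.e. [x]. The circle has measure 1, so the square of this bound is also a
    bound for the integral. *)
Lemma energy_step (B t t' : R) : t \in `[- T, T] -> t' \in `[- T, T] ->
  energy t = 0 ->
  (forall r, r \in `[- T, T] -> `|t - r| <= `|t - t'| -> energy r <= B) ->
  energy t' <= (B / 4 * `|t' - t|) ^+ 2.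
Proof.
move=> tT t'T Et EB.
have ut := integral_sqrD1_eq0 (u2 tT) Et.
have [_ i'] := square_integrableD1 (u2 t'T).
set C := _ ^+ 2.
have -> : C = \int[mu]_(x in `[0, 1[) C.
  by rewrite Rintegral_cst// [X in fine X]lebesgue_measure_co01 mulr1.
have iC := integrable_cst_co01 C.
have iB := integrableB measurable_co01 iC i'.
rewrite -subr_ge0 -RintegralB//; apply: ae_Rintegral_ge0 => //.
  by apply/measurable_EFinP; exact: (measurable_int mu iB).
apply: aeS (aeI ut (solutionB tT t'T)) => x [utx /= incr] xD.
rewrite subr_ge0 /C -[leLHS]real_normK ?num_real//.
rewrite ler_sqr ?nnegrE ?normr_ge0//; last first.
  by rewrite mulr_ge0// divr_ge0// (le_trans (energy_ge0 t))// EB// subrr normr0.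
have -> : u t' x + 1 = u t' x - u t x by rewrite utx// opprK.
rewrite incr// normrN.
have := @oriented_integralB_le _ T _ (nonlocal_term_time_integrable u2 udu xD)
  0 (B / 4) t t' tT t'T.
rewrite mul0r subr0; apply=> r /(itv_between tT t'T)[rT tr].
rewrite subr0 (le_trans (norm_nonlocal_term_le (u2 rT) xD))//.
by have := EB r rT tr; lra.
Qed.

(* The increment of [u] is at most [1/4] times the time integral of the energy, so
   that a bound [B <= M] for the energy improves to [d^2 B^2 / 16 <= B / 2]. *)
Lemma energy_local_eq0 (M d t : R) : 0 <= M -> 0 < d -> d ^+ 2 * M <= 8 ->
  (forall r, r \in `[- T, T] -> energy r <= M) ->
  t \in `[- T, T] -> energy t = 0 ->
  forall t', t' \in `[- T, T] -> `|t - t'| <= d -> energy t' = 0.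
Proof.
move=> M0 d0 dM EM tT Et.
have pow n : forall t', t' \in `[- T, T] -> `|t - t'| <= d ->
    energy t' <= M / 2 ^+ n.
  elim: n => [t' t'T _|n IH t' t'T tt']; first by rewrite expr0 divr1 EM.
  have H r : r \in `[- T, T] -> `|t - r| <= `|t - t'| -> energy r <= M / 2 ^+ n.
    by move=> rT tr; apply: IH => //; exact: le_trans tt'.
  apply: le_trans (energy_step tT t'T Et H) _.
  set B := M / 2 ^+ n.
  have B0 : 0 <= B by rewrite divr_ge0// exprn_ge0.
  have BM : B <= M.
    by rewrite ler_pdivrMr ?exprn_gt0// ler_peMr// exprn_ege1// ler1n.
  have -> : M / 2 ^+ n.+1 = B / 2 by rewrite exprSr invfM mulrA.
  rewrite distrC exprMn.
  have h2 : `|t - t'| ^+ 2 <= d ^+ 2 by rewrite ler_sqr ?nnegrE ?normr_ge0// ltW.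
  apply: (@le_trans _ _ ((B / 4) ^+ 2 * d ^+ 2)).
    by rewrite ler_wpM2l// sqr_ge0.
  have h3 : d ^+ 2 * B <= 8 by apply: le_trans dM; rewrite ler_wpM2l// sqr_ge0.
  have := ler_wpM2l B0 h3; nra.
move=> t' t'T tt'; apply/eqP; rewrite eq_le energy_ge0 andbT leNgt.
apply/negP => E0.
(* An integer [n > M / energy t'] suffices, because [n < 2 ^ n]. *)
have := archi_boundP (divr_ge0 M0 (ltW E0)); set n := Num.bound _ => Mn.
have := pow n t' t'T tt'; rewrite leNgt => /negP; apply.
rewrite ltr_pdivrMr ?exprn_gt0// mulrC -ltr_pdivrMr// (lt_trans Mn)//.
by rewrite -natrX ltr_nat ltn_expl.
Qed.

(** A global bound on the energy gives one step length [d] valid from every time, so finitely many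
    steps reach any [t']. *)
Lemma energy_eq0 t : 0 < T -> t \in `[- T, T] -> energy t = 0 ->
  forall t', t' \in `[- T, T] -> energy t' = 0.
Proof.
move=> T0 tT Et.
have [M0 EM0] := energy_bounded u2 udu T0.
(* With this [d] both [d] and [d * M] are at most 1, well within [d ^+ 2 * M <= 8]. *)
pose M := Num.max M0 0; pose d := (M + 1)^-1.
have M_ge0 : 0 <= M by rewrite le_max lexx orbT.
have EM r : r \in `[- T, T] -> energy r <= M.
  by move=> rT; rewrite le_max EM0.
have d0 : 0 < d by rewrite invr_gt0; lra.
have dM1 : d * (M + 1) = 1 by rewrite mulVf// gt_eqF//; lra.
have dM : d ^+ 2 * M <= 8.
  have d1 : d <= 1 by rewrite invf_le1; lra.
  have : d * M <= 1 by nra.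
  rewrite expr2 -mulrA => H.
  by have := mulr_ge0 (mulr_ge0 (ltW d0) M_ge0) (_ : 0 <= 1 - d); nra.
have steps k : forall t', t' \in `[- T, T] -> `|t - t'| <= d *+ k -> energy t' = 0.
  elim: k => [t' _|k IH t' t'T tt'].
    by rewrite mulr0n normr_le0 subr_eq0 => /eqP <-.
  (* The penultimate of [k + 1] equal steps from [t] to [t']: it is within [k d] of [t] and within
     [d] of [t'], and convexity keeps it in [[-T, T]]. *)
  pose r := t + (k%:R / k.+1%:R) * (t' - t).
  have k1 : (0 : R) < k.+1%:R by rewrite ltr0n.
  have rE : r = t' - k.+1%:R^-1 * (t' - t).
    by rewrite /r -[k.+1]addn1 natrD; field; rewrite -natr1 in k1; rewrite gt_eqF.
  have lam : 0 <= k%:R / k.+1%:R :> R by rewrite divr_ge0// ltW.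
  have lam1 : k%:R / k.+1%:R <= 1 :> R by rewrite ler_pdivrMr// mul1r ler_nat.
  have rT : r \in `[- T, T].
    move: tT t'T lam lam1; rewrite !in_itv/= /r; move: (k%:R / _) => l.
    by move=> /andP[? ?] /andP[? ?] ? ?; apply/andP; split; nra.
  have tr : `|t - r| <= d *+ k.
    rewrite /r opprD addNKr normrN normrM ger0_norm// distrC.
    apply: le_trans (ler_wpM2l lam tt') _.
    by rewrite -[d *+ k.+1]mulr_natr -[d *+ k]mulr_natr mulrCA divfK ?gt_eqF.
  apply: (energy_local_eq0 M_ge0 d0 dM EM rT (IH r rT tr) t'T).
  rewrite rE addrAC subrr sub0r normrN normrM distrC ger0_norm ?invr_ge0 ?(ltW k1)//.
  by rewrite ler_pdivrMl// mulr_natl.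
move=> t' t'T.
have := archi_boundP (divr_ge0 (normr_ge0 (t - t')) (ltW d0)).
rewrite ltr_pdivrMr// mulr_natl => /ltW; exact: steps.
Qed.

(** A weak form of [du = - nonlocal_term], at one point of each interval: the difference quotient is
    close to [- nonlocal_term] a.e. and to [du t] in mean square, hence to both at a common
    point. *)
Lemma time_derivative_nonlocal (t c d e : R) : t \in `]- T, T[ ->
  0 <= c -> c < d -> d <= 1 -> 0 < e ->
  exists x, [/\ c < x, x < d & `|du t x + nonlocal_term (u t) x| <= e].
Proof.
rewrite in_itv/= => /andP[Tt tT'] c0 cd d1 e0.
have tT : t \in `[- T, T] by rewrite in_itv/= !ltW.
have h0 : 0 < e / 2 by rewrite divr_gt0.
have dc0 : 0 < d - c by rewrite subr_gt0.
have [e' e'0 e'n] : exists2 e', 0 < e' & e' ^+ 2 < (e / 2) ^+ 2 * (d - c).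
  (* The square is [(e / 2)^2 ((d - c) / 2)^2], below the threshold as [0 < d - c <= 1]. *)
  exists (e / 2 * ((d - c) / 2)); first by rewrite !mulr_gt0.
  rewrite exprMn ltr_pM2l ?exprn_gt0//.
  have : d - c <= 1 by lra.
  by move: (d - c) dc0 => m; nra.
have [d1' d10 d1P] := time_quotient u2 udu tT e'0.
have [d2 d20 d2P] := nonlocal_term_time_delta u2 udu tT h0.
have Tt0' : 0 < T - t by rewrite subr_gt0.
(* The second time is [t + r]; the bound [r <= T - t] keeps it in [[-T, T]]. *)
have [r [r0 r1 r2 r3]] := exists_pos_lt Tt0' d10 d20.
have [t' t't] : exists t', t' - t = r by exists (r + t); rewrite addrK.
have tt' : `|t - t'| = r by rewrite distrC t't ger0_norm// ltW.
have t'T : t' \in `[- T, T] by rewrite in_itv/=; apply/andP; split; lra.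
have t'n : t' != t by rewrite -subr_eq0 t't gt_eqF.
pose q x := (u t' x - u t x) / (t' - t).
have qF : {ae mu, forall x, x \in `[0, 1[ -> `|q x + nonlocal_term (u t) x| <= e / 2}.
  apply: aeS (solutionB tT t'T) => x incr xD.
  pose O := oriented_integral (fun p => nonlocal_term (u p) x) t'
            - oriented_integral (fun p => nonlocal_term (u p) x) t.
  have uO : u t' x - u t x = - O by exact: incr.
  have H : `|O - nonlocal_term (u t) x * (t' - t)| <= e / 2 * `|t' - t|.
    apply: (oriented_integralB_le (nonlocal_term_time_integrable u2 udu xD)) => //.
    move=> p /(itv_between tT t'T)[pT tp]; apply: d2P => //.
    by apply: le_lt_trans tp _; rewrite tt'.
  have -> : q x + nonlocal_term (u t) x =
      - ((O - nonlocal_term (u t) x * (t' - t)) / (t' - t)).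
    by rewrite /q uO; field; rewrite subr_eq0.
  by rewrite normrN normrM normfV ler_pdivrMr// normr_gt0 subr_eq0.
pose g x := q x - du t x.
have g2 : square_integrable mu D g.
  apply: (square_integrableB measurable_co01).
    exact: (square_integrableZ measurable_co01 (t' - t)^-1
      (square_integrableB measurable_co01 (u2 t'T) (u2 tT))).
  by apply: continuous_square_integrable; exact: (continuous_time_derivative udu tT).
have gsmall : \int[mu]_(x in `[0, 1[) (g x ^+ 2) < (e / 2) ^+ 2 * (d - c).
  by apply: le_lt_trans e'n; apply: d1P => //; rewrite tt'.
have [x [cx xd qFx gx]] := ae_pick_small g2 qF c0 cd d1 (ltW h0) gsmall.
exists x; split=> //.
have -> : du t x + nonlocal_term (u t) x = q x + nonlocal_term (u t) x - g x.
  by rewrite /g; ring.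
apply: le_trans (ler_normB _ _) _; rewrite [leRHS]splitr lerD//.
by apply: qFx; rewrite in_itv/= (ltW (le_lt_trans c0 cx)) (lt_le_trans xd).
Qed.

(** The points [a] and [b] are replaced by generic [x1], [x2] inside [(a, b)], and continuity of
    [du t] brings the strict inequality back to [a] and [b]. *)
Lemma time_derivative_lt (t a b K : R) : t \in `]- T, T[ ->
  0 <= a -> a < b -> b < 1 -> 0 < K ->
  (forall x1 x2, a < x1 -> x1 <= x2 -> x2 < b ->
    K * (x2 - x1) <= nonlocal_term (u t) x2 - nonlocal_term (u t) x1) ->
  du t b < du t a.
Proof.
move=> tT' a0 ab b1 K0 HK.
have tT : t \in `[- T, T] by move: tT'; rewrite !in_itv/= => /andP[? ?]; rewrite !ltW.
(* Four errors of size [e] cannot absorb a gap of [8 * e]. *)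
have contract (e A B A1 B1 N1 N2 : R) : 0 < e -> 8 * e <= N2 - N1 ->
    `|A1 + N1| <= e -> `|B1 + N2| <= e -> `|A - A1| <= e -> `|B - B1| <= e -> B < A.
  move=> e0 e8; rewrite !ler_norml.
  by move=> /andP[? ?] /andP[? ?] /andP[? ?] /andP[? ?]; lra.
(* Margins of at most a third of the length leave at least a third between the two points, which
   fixes [e] below. *)
have apart (n y1 y2 : R) : n <= (b - a) / 3 -> y1 < a + n -> b - n < y2 ->
    (b - a) / 3 <= y2 - y1 by move=> *; lra.
have inside (n : R) : n <= (b - a) / 3 -> 0 <= b - n /\ a + n <= 1.
  by move=> ?; split; lra.
have ab3 : 0 < (b - a) / 3 by rewrite divr_gt0 ?subr_gt0.
have [e eE e0] : exists2 e, 8 * e = K * ((b - a) / 3) & 0 < e.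
  by exists (K * ((b - a) / 3) / 8); [field|apply: divr_gt0 => //; exact: mulr_gt0].
have cdu := continuous_time_derivative udu tT.
have [da da0 daP] := continuous_delta a cdu e0.
have [db db0 dbP] := continuous_delta b cdu e0.
have [n [n0 n1 n2 n3]] := exists_pos_lt ab3 da0 db0.
have [bn0 an1] := inside n n1.
have an : a < a + n by rewrite ltrDl.
have bn : b - n < b by rewrite ltrBlDr ltrDl.
have [x1 [ax1 x1n F1]] := time_derivative_nonlocal tT' a0 an an1 e0.
have [x2 [bx2 x2b F2]] := time_derivative_nonlocal tT' bn0 bn (ltW b1) e0.
have x12 := apart n x1 x2 n1 x1n bx2.
apply: (contract e (du t a) (du t b) _ _ _ _ e0 _ F1 F2).
- rewrite eE; apply: le_trans (HK _ _ ax1 _ x2b); first by rewrite ler_pM2l.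
  by rewrite -subr_ge0 (le_trans (ltW ab3)).
- by apply: daP; rewrite distrC gtr0_norm ?subr_gt0// (lt_trans _ n2)// ltrBlDl.
- by apply: dbP; rewrite gtr0_norm ?subr_gt0// (lt_trans _ n3)// ltrBlDl -ltrBlDr.
Qed.

Lemma energy_eq0_of_time_derivative (t a b : R) : t \in `]- T, T[ ->
  a \in `[0, 1[ -> b \in `[0, 1[ -> a < b ->
  {ae mu, forall x, x \in `]a, b[ -> u t x = -1} ->
  du t a <= du t b -> energy t = 0.
Proof.
move=> tT'; rewrite !in_itv/= => /andP[a0 _] /andP[_ b1] ab uab.
have tT : t \in `[- T, T] by move: tT'; rewrite !in_itv/= => /andP[? ?]; rewrite !ltW.
rewrite leNgt => /negP duab; apply/eqP; rewrite eq_le energy_ge0 andbT leNgt.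
apply/negP => E0; apply: duab.
have K0 : 0 < (8 * sinh (1 / 2 : R))^-1 * energy t.
  by rewrite mulr_gt0// invr_gt0 mulr_gt0// sinh_half_gt0.
apply: (time_derivative_lt tT' a0 ab b1 K0) => x1 x2 ax1 x12 x2b.
by rewrite mulrAC; exact: nonlocal_term_increment (u2 tT) a0 b1 ax1 x12 x2b uab.
Qed.


End rigidity.

(** * Null sets of space-time and the conclusion *)

Lemma product_measure_eq0 d1 d2 (T1 : measurableType d1) (T2 : measurableType d2)
    (R : realType) (m1 : {sigma_finite_measure set T1 -> \bar R})
    (m2 : {sigma_finite_measure set T2 -> \bar R}) (N : set (T1 * T2)) :
  measurable N -> (forall y, m1 (ysection N y) = 0%E) -> (m1 \x m2)%E N = 0%E.
Proof.
(* Tonelli: the product measure of [N] is the integral over the second variable of the measures of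
   its sections. *)
move=> mN N0; rewrite -[N]setIT -integral_indic// fubini_tonelli2//=.
- apply: integral0_eq => y _.
  by have := congr1 (@^~ y) (indic_fubini_tonelli_GE m1 mN) => /= ->; exact: N0.
- exact/measurable_EFinP.
Qed.

Theorem theorem1p9 (R : realType) (s T : R) (u0 : R -> R)
    (u du : R -> R -> R) (t0 a b : R) :
  0 <= s -> 0 < T ->
  Hs s u0 ->
  is_solution s T u0 u ->
  space_time_representative s T u ->
  is_time_derivative T u du ->
  t0 \in `]- T, T[ ->
  a \in `[0, 1[ -> b \in `[0, 1[ -> a < b ->
  (\forall x \ae @lebesgue_measure R, x \in `]a, b[ -> u t0 x = -1) ->
  du t0 a <= du t0 b ->
  (1 / 2 < s ->
     forall x t : R, x \in `[0, 1[ -> t \in `[- T, T] -> u t x = -1) /\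
  (s <= 1 / 2 ->
     \forall z \ae (@lebesgue_measure R \x @lebesgue_measure R)%E,
       z.1 \in `[0, 1[ -> z.2 \in `[- T, T] -> u z.2 z.1 = -1).
Proof.
move=> _ T0 _ [[uHs _] usol] [ucont umeas] udu t0T aD bD ab uab dab.
have u2 t : t \in `[- T, T] -> square_integrable lebesgue_measure `[0, 1[%classic (u t).
  by move=> /uHs[/L2_square_integrable].
have t0T' : t0 \in `[- T, T].
  by move: t0T; rewrite !in_itv/= => /andP[? ?]; rewrite !ltW.
have E0 := energy_eq0_of_time_derivative u2 udu usol t0T aD bD ab uab dab.
have uae t (tT : t \in `[- T, T]) :=
  integral_sqrD1_eq0 (u2 t tT) (energy_eq0 u2 udu usol T0 t0T' E0 tT).
split=> [s12 x t xD tT|s12].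
  exact: continuous_ae_eq_cst (ucont s12 t tT) (uae t tT) x xD.
(* The exceptional set is measurable by joint measurability of [u], and each of its sections at a
   fixed time is null; only then does Tonelli apply. *)
pose N := (`[0, 1[%classic `*` `[- T, T]%classic) `&`
  (fun z : R * R => u z.2 z.1) @^-1` (~` [set -1]).
have mN : measurable (N : set (measurableTypeR R * measurableTypeR R)).
  apply: umeas => //; first by apply: measurableX; exact: measurable_itv.
  by apply: measurableC; exact: measurable_set1.
exists N; split=> //; last first.
  move=> z /= nP; split; last by move=> /= uz; apply: nP.
  by split; apply: contrapT => H; apply: nP.
apply: product_measure_eq0 => // t.
have [tT|tT] := boolP (t \in `[- T, T]); last first.
  rewrite (_ : ysection N t = set0) ?measure0//.
  by apply/seteqP; split=> // x; rewrite /ysection/= inE => -[[_ /= tT']]; rewrite tT' in tT.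
have [A [mA A0 sA]] := uae t tT.
apply: (subset_measure0 _ mA _ A0); first exact: measurable_ysection.
move=> x; rewrite /ysection/= inE => -[[/= xD _] ux]; apply: sA => /= H.
exact: ux (H xD).
Qed.
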